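(* Let $\mathbb{X}$ be one of the following structures: (i) the random graph; (ii) the random directed graph; (iii) the graph $\omega\mathbb{K}_n$ for $n\in\mathbb{N}$; (iv) the graph $n\mathbb{K}_\omega$ with loops for $n\in\mathbb{N}\cup\{\omega\}$, i.e. the random equivalence relation with $n$ countably infinite equivalence classes; or one of the structures (i)-(iii) with all the loops included. Then $\operatorname{End}(\mathbb{X})$ equipped with the pointwise topology has automatic continuity with respect to the class of second countable topological semigroups.
   Context: The random graph and random directed graph are the Fra\''iss\'e limits of the classes of all finite loopless undirected graphs and of all finite directed graphs, respectively; a directed graph is a set with an irreflexive binary relation that need not be symmetric or antisymmetric. $\mathbb{K}_m$ is the complete loopless graph on $m$ vertices and $n\mathbb{K}_m$ is the disjoint union of $n$ copies of $\mathbb{K}_m$. ''With loops'' means that all pairs $(x,x)$ are added to the relation. $\operatorname{End}(\mathbb{X})$ is the endomorphism monoid of $\mathbb{X}$; the pointwise topology on it has subbasis the sets $\{f : (x)f=y\}$, $x,y\in X$, where $(x)f$ is the image of $x$ under $f$. A topological semigroup $S$ has automatic continuity with respect to a class $\mathcal{C}$ of topological semigroups if every semigroup homomorphism from $S$ to a member of $\mathcal{C}$ is continuous. A topological semigroup is a semigroup with a topology for which multiplication is jointly continuous. *)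

(* Defs.v *)
From HB Require Import structures.
From mathcomp Require Import all_boot.
From mathcomp Require Import all_classical topology.

Set Implicit Arguments.
Unset Strict Implicit.
Unset Printing Implicit Defensive.

Local Open Scope classical_set_scope.
Local Open Scope group_scope.

HB.mixin Record Semigroup_isTopological S of Topological S & Semigroup S := {
  mulg_continuous : continuous (fun p : S * S => p.1 * p.2)
}.

#[short(type="topSemigroupType")]
HB.structure Definition TopologicalSemigroup :=
  {S of Topological S & Semigroup S & Semigroup_isTopological S}.

Definition automatic_continuity (S : topSemigroupType)
    (C : topSemigroupType -> Prop) : Prop :=
  forall T : topSemigroupType, C T ->
  forall f : {multiplicative S -> T}, continuous f.

Definition second_countable_semigroup (T : topSemigroupType) : Prop :=
  second_countable (T := T).

Record relStr := RelStr {
  carrier :> Type;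
  edge : carrier -> carrier -> Prop
}.
Arguments edge {r} x y.

Definition embedding (A B : relStr) (f : A -> B) : Prop :=
  injective f /\ forall x y, edge x y <-> edge (f x) (f y).

Definition isomorphism (A B : relStr) (f : A -> B) : Prop :=
  bijective f /\ forall x y, edge x y <-> edge (f x) (f y).

Definition isomorphic (A B : relStr) : Prop :=
  exists f : A -> B, isomorphism f.

Definition add_loops (A : relStr) : relStr :=
  @RelStr A (fun x y => edge x y \/ x = y).

Definition complete (V : Type) : relStr := @RelStr V (fun x y => x <> y).

(* The disjoint union of copies of [A], one for each element of [I]. *)
Definition copies (I : Type) (A : relStr) : relStr :=
  @RelStr (I * A) (fun p q => p.1 = q.1 /\ edge p.2 q.2).

(* Ultrahomogeneity. In a language with one binary relation every subset
   carries a substructure, so an isomorphism between finite substructures is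
   given by a finite domain F and an f that is injective on F and preserves and
   reflects the relation there; the codomain is f @` F. *)
Definition homogeneous (A : relStr) : Prop :=
  forall (F : set A) (f : A -> A), finite_set F -> set_inj F f ->
    (forall x y, F x -> F y -> (edge x y <-> edge (f x) (f y))) ->
  exists2 g : A -> A, isomorphism g & (forall x, F x -> f x = g x).

Definition age (A B : relStr) : Prop :=
  finite_set [set: B] /\ exists f : B -> A, embedding f.

Definition fraisse_limit (K : relStr -> Prop) (A : relStr) : Prop :=
  [/\ countable [set: A], homogeneous A & forall B, age A B <-> K B].

Definition finite_digraph (A : relStr) : Prop :=
  finite_set [set: A] /\ forall x : A, ~ edge x x.

Definition finite_graph (A : relStr) : Prop :=
  finite_digraph A /\ forall x y : A, edge x y -> edge y x.

Definition random_graph : relStr -> Prop := fraisse_limit finite_graph.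

Definition random_digraph : relStr -> Prop := fraisse_limit finite_digraph.

Record endo (X : relStr) := Endo {
  endo_fun :> X -> X;
  endo_edge : forall x y, edge x y -> edge (endo_fun x) (endo_fun y)
}.

Lemma endo_inj (X : relStr) : injective (@endo_fun X).
Proof.
move=> [f fP] [g gP] /= fg; rewrite fg in fP *.
by congr Endo; exact: Prop_irrelevance.
Qed.

HB.instance Definition _ (X : relStr) := gen_eqMixin (endo X).
HB.instance Definition _ (X : relStr) := gen_choiceMixin (endo X).

Definition endo_id (X : relStr) : endo X := @Endo X id (fun x y xy => xy).

(* Functions act on the right: [f * g] is [f] followed by [g]. *)
Definition endo_mul (X : relStr) (f g : endo X) : endo X :=
  @Endo X (g \o f) (fun x y xy => endo_edge g (endo_edge f xy)).

Lemma endo_mulA (X : relStr) : associative (@endo_mul X).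
Proof. by move=> f g h; exact: endo_inj. Qed.

Lemma endo_mul1 (X : relStr) : left_id (endo_id X) (@endo_mul X).
Proof. by move=> f; exact: endo_inj. Qed.

Lemma endo_1mul (X : relStr) : right_id (endo_id X) (@endo_mul X).
Proof. by move=> f; exact: endo_inj. Qed.

HB.instance Definition _ (X : relStr) :=
  isMonoid.Build (endo X) (@endo_mulA X) (@endo_mul1 X) (@endo_1mul X).

Definition endo_subbase (X : relStr) : set (set (endo X)) :=
  [set U | exists x y : X, U = [set f : endo X | f x = y]].

HB.instance Definition _ (X : relStr) :=
  isSubBaseTopological.Build (endo X) (endo_subbase (X := X)) id.

Lemma endo_mul_continuous (X : relStr) :
  continuous (fun p : endo X * endo X => p.1 * p.2).
Proof.
move=> [f g] /= W; rewrite nbhsE => -[U [[D sD <-] [V DV Vfg]] sUW].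
have [E sE VE] := sD _ DV.
suff /filterS : nbhs (f, g) (fun p : endo X * endo X => V (p.1 * p.2)).
  by apply=> p Vp; apply: sUW; exists V.
rewrite -VE in Vfg *; apply: filter_bigI => i iE.
have /set_mem [x [y iE']] := sE _ iE.
have op (a b : X) : open [set h : endo X | h a = b].
  exists [set [set h : endo X | h a = b]]; last by rewrite bigcup_set1.
  by move=> _ ->; apply: finI_from1; exists a, b.
exists ([set h : endo X | h x = f x], [set h : endo X | h (f x) = y]) => /=.
  split; apply: open_nbhs_nbhs; split => //=.
  by have := Vfg _ iE; rewrite iE'.
by move=> [h k] /= [hx kx]; rewrite iE' /= hx.
Qed.

HB.instance Definition _ (X : relStr) :=
  Semigroup_isTopological.Build (endo X) (@endo_mul_continuous X).

(* Main.v *)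
(** Suppose that [phi : End X -> T] is not continuous at [s]. Enumerating [X]
    with finite-to-one ranks, there are an open [W] containing [phi s] and
    endomorphisms [u N] which agree with [s] on the points of rank at most [N]
    and such that [phi (u N)] is not in [W]. Assume that we can find
    endomorphisms [P a] and [Q a], for [a] in the Cantor space, such that
    [P a * Q a = s] while [P a * Q b] is one of the [u N] whenever [a <> b].
    By continuity of the product in [T] there are basic open sets [U a] and
    [V a], containing [phi (P a)] and [phi (Q a)], with [U a * V a] inside [W].
    As there are countably many basic open sets, some [a <> b] have the same
    [U] and [V], whence [phi (P a * Q b)] is in [W]: a contradiction.

    To construct [P] and [Q], attach to [x] the word formed by the first [m x]
    values of [a], where [m x] is the rank of [x], and let [Q b] send [x] with
    the word [w] to [u (lcp w b) x], where [lcp w b] is the length of the longest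
    common prefix of [w] and [b]. If [a] and [b] first differ at [N] this gives
    [u N x], since [u k x = s x] for all [k >= m x]. It remains to realize the
    pairs [(x, w)] inside [X] so that [P a] and [Q b] are homomorphisms. *)

Require Import Defs.
From HB Require Import structures.
From mathcomp Require Import all_boot.
From mathcomp Require Import all_classical topology.

Set Implicit Arguments.
Unset Strict Implicit.
Unset Printing Implicit Defensive.

Local Open Scope classical_set_scope.

(** * Common prefixes of words and points of the Cantor space *)

Fixpoint lcp (w : seq bool) (b : nat -> bool) : nat :=
  if w is c :: w' then if c == b 0 then (lcp w' (b \o succn)).+1 else 0 else 0.

Lemma mkseqS T (a : nat -> T) n : mkseq a n.+1 = a 0 :: mkseq (a \o succn) n.
Proof. by rewrite /mkseq /= (iotaDl 1 0) -map_comp. Qed.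

Lemma lcp_mkseq b n : lcp (mkseq b n) b = n.
Proof. by elim: n b => // n IHn b; rewrite mkseqS /= eqxx IHn. Qed.

Lemma lcp_mkseq_neq a b :
  a <> b -> exists N, forall n, lcp (mkseq a n) b = minn n N.
Proof.
move=> ab; have ex : exists n, a n != b n.
  apply: contra_notP ab => /forallNP ab; apply/funext => n.
  by apply/eqP/negP/negP; rewrite -[_ == _]negbK; apply/negP/ab.
case: (ex_minnP ex) => N Nab minN {ab ex}; exists N => n.
elim: n a b N Nab minN => [|n IHn] a b N Nab minN; first by rewrite min0n.
rewrite mkseqS /=; case: N Nab minN => [/negPf->|N Nab minN]; first by rewrite minn0.
have /eqP -> : a 0 == b 0 by rewrite -[_ == _]negbK; apply/negP => /minN.
rewrite eqxx minnSS (IHn _ _ N) // => k /= kab.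
by rewrite -ltnS; exact: minN.
Qed.

(** Either [w] already departs from [b], so that a continuation changes nothing, or [w] is a prefix
    of [b]. *)
Lemma lcp_cat w b :
  (forall v, lcp (w ++ v) b = lcp w b) \/ (forall v, size w <= lcp (w ++ v) b).
Proof.
elim: w b => [|c w IHw] b; first by right.
rewrite /=; case: eqP => _; last by left.
by case: (IHw (b \o succn)) => h; [left=> v; rewrite h|right].
Qed.

Lemma no_injection_cantor (T : countType) (c : (nat -> bool) -> T) :
  exists a b, a <> b /\ c a = c b.
Proof.
(* Cantor's diagonal: [d] cannot be true at its own code, so some [a] with that code is true there
   and differs from [d]. *)
pose d n := `[<forall a, pickle (c a) = n -> a n = false>].
have [dn|/asboolPn/existsNP[a /not_implyP[ca an]]] :=
  boolP (d (pickle (c d))).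
  by have /asboolP/(_ d erefl) := dn; rewrite dn.
exists a, d; split; last exact: pcan_inj (@pickleK T) _ _ ca.
move=> ad; apply: an; rewrite ad; apply/negP => dn.
by have /asboolP/(_ d erefl) := dn; rewrite dn.
Qed.

(** * From diagonalization to automatic continuity *)

Lemma nbhs_agree (X : relStr) (s : endo X) (F : set X) : finite_set F ->
  nbhs s [set f : endo X | forall x, F x -> f x = s x].
Proof.
have op (a b : X) : open [set f : endo X | f a = b].
  exists [set [set f : endo X | f a = b]]; last by rewrite bigcup_set1.
  by move=> _ ->; apply: finI_from1; exists a, b.
move=> finF; have [r ->] := (@finite_seqP {classic X} F).1 finF.
elim: r => [|x r IHr]; first by apply: filterS filterT => f _ x.
have sx : nbhs s [set f : endo X | f x = s x] by apply: open_nbhs_nbhs; split.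
apply: filterS2 sx IHr => f fx fr y /=; rewrite inE => /orP[/eqP->//|].
exact: fr.
Qed.

(* By [lcp_mkseq] and [lcp_mkseq_neq], the last equation says that
   [P a * Q a = s] and that, for [a <> b], [P a * Q b] is some [u N]. *)
Definition diagonalizable (X : relStr) : Prop :=
  exists2 m : X -> nat, (forall N, finite_set [set x | m x <= N]) &
    forall (s : endo X) (u : nat -> endo X),
      (forall N x, m x <= N -> u N x = s x) ->
    exists P Q : (nat -> bool) -> endo X,
      forall a b x, Q b (P a x) = u (lcp (mkseq a (m x)) b) x.

Lemma diagonalizable_automatic_continuity (X : relStr) :
  diagonalizable X -> automatic_continuity (endo X) second_countable_semigroup.
Proof.
move=> [m finm diag] T [B /countable_injP[c cinj] [Bopen Bbasis]] phi s W Wphi.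
suff [N sN] : exists N, forall t : endo X,
    (forall x, m x <= N -> t x = s x) -> W (phi t).
  exact: filterS sN (nbhs_agree s (finm N)).
apply: contrapT => /forallNP noN.
have /choice[u uP] N : exists t : endo X,
    (forall x, m x <= N -> t x = s x) /\ ~ W (phi t).
  by have /existsNP[t /not_implyP[? ?]] := noN N; exists t.
have us N x : m x <= N -> u N x = s x by move/(uP N).1.
have [P [Q PQ]] := diag s u us.
have PQs a : (P a * Q a)%g = s.
  by apply/endo_inj/funext => x; rewrite /= PQ lcp_mkseq us.
have PQu a b : a <> b -> exists N, (P a * Q b)%g = u N.
  move=> /lcp_mkseq_neq[N abN]; exists N.
  apply/endo_inj/funext => x; rewrite /= PQ abN.
  by case: (leqP (m x) N) => // mN; rewrite !us.
have /choice[UV UVP] a : exists UV : set T * set T,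
    [/\ B UV.1, B UV.2, UV.1 (phi (P a)), UV.2 (phi (Q a)) &
       forall x y, UV.1 x -> UV.2 y -> W (x * y)%g].
  have : nbhs (phi (P a) * phi (Q a))%g W by rewrite -gmulfM PQs.
  move=> /(@mulg_continuous T (phi (P a), phi (Q a)))[[U' V'] /= [nU' nV'] sW].
  have [U [BU Ux] sU] := Bbasis _ _ nU'; have [V [BV Vx] sV] := Bbasis _ _ nV'.
  by exists (U, V); split => // x y /sU ? /sV ?; exact: (sW (x, y)).
have [a [b [ab [c1 c2]]]] :=
  no_injection_cantor (fun a => (c (UV a).1, c (UV a).2)).
have [B1 B2 Pa Qa aW] := UVP a; have [B1' B2' Pb Qb bW] := UVP b.
have [N uN] := PQu _ _ ab; apply: (uP N).2.
rewrite -uN gmulfM; apply: aW => //.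
by rewrite (cinj _ _ _ _ c2) ?inE.
Qed.

(** * Transport along isomorphisms *)

Lemma isomorphic_diagonalizable (X Y : relStr) :
  isomorphic X Y -> diagonalizable Y -> diagonalizable X.
Proof.
move=> [f [[g fK gK] fE]] [m finm diag].
have gE x y : edge x y <-> edge (g x) (g y) by rewrite fE !gK.
exists (m \o f) => [N|s u us].
  have -> : [set x | (m \o f) x <= N] = f @^-1` [set y | m y <= N] by [].
  by apply: finite_preimage (finm N) => x y _ _; exact: (can_inj fK).
pose toY (t : endo X) := @Endo Y (f \o t \o g)
  (fun x y xy => (fE _ _).1 (endo_edge t ((gE _ _).1 xy))).
pose toX (t : endo Y) := @Endo X (g \o t \o f)
  (fun x y xy => (gE _ _).1 (endo_edge t ((fE _ _).1 xy))).
have [N y /= mN|P [Q PQ]] := diag (toY s) (toY \o u).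
  by rewrite us //= gK.
by exists (toX \o P), (toX \o Q) => a b x /=; rewrite gK PQ /= !fK.
Qed.

Lemma isomorphic_add_loops (X Y : relStr) :
  isomorphic X Y -> isomorphic (add_loops X) (add_loops Y).
Proof.
move=> [f [fbij fE]]; exists f; split=> // x y; rewrite /= -fE.
have [g fK gK] := fbij.
by split=> -[xy|xy]; [left|right; rewrite xy|left|right; apply: (can_inj fK)].
Qed.

Lemma isomorphic_add_loops_copies (I : Type) (A : relStr) :
  isomorphic (add_loops (copies I A)) (copies I (add_loops A)).
Proof.
exists id; split=> [|[i a] [j b] /=]; first by exists id.
split=> [[[-> ab]|[-> ->]]|[-> [ab|->]]]; first by split=> //; left.
- by split=> //; right.
- by left.
- by right.
Qed.

(** * Disjoint unions of complete graphs *)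

Lemma mkseqD T (a : nat -> T) m n :
  mkseq a (m + n) = mkseq a m ++ mkseq (fun k => a (m + k)) n.
Proof. by rewrite /mkseq iotaD map_cat add0n -[X in iota X n]addn0 iotaDl -map_comp. Qed.

Lemma finite_set_leq N : finite_set [set n | n <= N].
Proof. exact: finite_II N.+1. Qed.

(* [P a] moves the component [i] to a component coding [i] and the word
   [mkseq a i], from which [Q b] reads off which [u N] to apply. *)
Lemma diagonalizable_copies (A : relStr) :
  finite_set [set: A] -> diagonalizable (copies nat A).
Proof.
move=> finA; exists fst => [N|s u us].
  apply: sub_finite_set (finite_setX (finite_set_leq N) finA).
  by move=> [i x] /= iN.
pose dec j : nat * seq bool := odflt (0, [::]) (unpickle j).
pose P (a : nat -> bool) (x : copies nat A) : copies nat A := (pickle (x.1, mkseq a x.1), x.2).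
pose Q b (y : copies nat A) : copies nat A :=
  u (lcp (dec y.1).2 b) ((dec y.1).1, y.2).
have P_edge a x y : edge x y -> edge (P a x) (P a y).
  by case=> xy1 xy2; split=> //=; rewrite xy1.
have Q_edge b x y : edge x y -> edge (Q b x) (Q b y).
  by rewrite /Q; case=> -> xy; apply: endo_edge; split.
exists (fun a => @Endo (copies nat A) _ (P_edge a)).
exists (fun b => @Endo (copies nat A) _ (Q_edge b)).
by move=> a b [i x] /=; rewrite /Q /P /dec pickleK.
Qed.

(* [Q b] may apply different [u N] to two points of the class [i] only if all
   these [N] are at least [r i]: then [u N] and [s] agree on [(i, 0)], so [u N]
   sends the class [i] to the same class as [s] does. The first [r i] letters of
   the word of a point of the class [i] are therefore stored in its class, by
   [c], and the remaining ones in its second coordinate. *)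
Lemma diagonalizable_equivalence (I : Type) (r : I -> nat)
    (c : I -> seq bool -> I) (d : I -> I * seq bool) :
  (forall N, finite_set [set i | r i <= N]) ->
  (forall j, size (d j).2 = r (d j).1) ->
  (forall i w, size w = r i -> d (c i w) = (i, w)) ->
  diagonalizable (add_loops (copies I (complete nat))).
Proof.
move=> finr dr cK; set X := add_loops _.
have edgeE (x y : X) : edge x y <-> x.1 = y.1.
  case: x y => [i k] [j l] /=; split=> [[[]|[]]//|->].
  by have [->|/eqP] := eqVneq k l; [right|left].
exists (fun x : X => r x.1 + x.2) => [N|s u us].
  apply: sub_finite_set (finite_setX (finr N) (finite_set_leq N)).
  by move=> [i k] /= ikN; split; apply: leq_trans ikN; rewrite ?leq_addl ?leq_addr.
pose dec l : nat * seq bool := odflt (0, [::]) (unpickle l).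
pose tl (a : nat -> bool) (x : X) : seq bool := mkseq (fun k => a (r x.1 + k)) x.2.
pose P a (x : X) : X := (c x.1 (mkseq a (r x.1)), pickle (x.2, tl a x)).
pose Q b (y : X) : X :=
  u (lcp ((d y.1).2 ++ (dec y.2).2) b) ((d y.1).1, (dec y.2).1).
have P_edge a x y : edge x y -> edge (P a x) (P a y).
  by move/edgeE => xy; apply/edgeE; rewrite /= xy.
have u_class N i k l : (u N (i, k)).1 = (u N (i, l)).1.
  by apply/edgeE/endo_edge/edgeE.
have Q_edge b x y : edge x y -> edge (Q b x) (Q b y).
  move/edgeE => xy; apply/edgeE; rewrite /Q xy.
  have [lcpE|le_lcp] := lcp_cat (d y.1).2 b; first by rewrite !lcpE; exact: u_class.
  rewrite (u_class _ _ _ 0) (u_class _ _ (dec y.2).1 0).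
  by rewrite !us //= addn0 -dr.
exists (fun a => @Endo X _ (P_edge a)), (fun b => @Endo X _ (Q_edge b)).
move=> a b [i k]; rewrite /= /Q /P /= cK ?size_mkseq //.
by rewrite /dec pickleK /= -mkseqD.
Qed.

Lemma diagonalizable_finite_equivalence n :
  diagonalizable (add_loops (copies 'I_n (complete nat))).
Proof.
(* With finitely many classes all can have rank 0, so a class stores only the empty word. *)
apply: (@diagonalizable_equivalence _ (fun=> 0) (fun i _ => i) (fun i => (i, [::]))) => //.
by move=> i [].
Qed.

Lemma diagonalizable_countable_equivalence :
  diagonalizable (add_loops (copies nat (complete nat))).
Proof.
(* Invalid codes decode to class 0, whose word must be empty. *)
pose d j : nat * seq bool :=
  if unpickle j is Some (i, w) then if size w == i then (i, w) else (0, [::])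
  else (0, [::]).
apply: (@diagonalizable_equivalence _ id (fun i w => pickle (i, w)) d).
- exact: finite_set_leq.
- by move=> j; rewrite /d; case: unpickle => [[i w]|//]; case: eqP.
- by move=> i w sw; rewrite /d pickleK sw eqxx.
Qed.

(** * Rich structures *)

Lemma history_choice (T : Type) (R : seq T -> T -> Prop) :
  (forall l, exists x, R l x) -> exists v, forall n, R (mkseq v n) (v n).
Proof.
move=> /choice[step stepP].
pose h n := iter n (fun l => rcons l (step l)) [::].
exists (step \o h) => n; suff -> : mkseq (step \o h) n = h n by exact: stepP.
by elim: n => // n IHn; rewrite -addn1 mkseqD IHn /= cats1 addn0 addn1.
Qed.

(* The last clause realizes every one-point extension of a finite [F], where [I]
   and [O] prescribe the neighbours of the new point; in a symmetric structure
   only the types with [I = O] are consistent. Loops are left out of it, so that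
   the notion is stable under [add_loops]. *)
Definition rich (X : relStr) : Prop :=
  [/\ countable [set: X],
      (forall x : X, edge x x) \/ (forall x : X, ~ edge x x) &
      forall (F : set X) (I O : set X), finite_set F ->
        ((forall x y : X, edge x y -> edge y x) -> I = O) ->
      exists2 v, ~ F v &
        forall x, F x -> (edge x v <-> I x) /\ (edge v x <-> O x)].

(* The points [i n] are chosen one at a time, each [i n] avoiding and being
   non-adjacent to every [x] outside the image with [e x <= n]. So a point
   outside the image has neighbours among finitely many [i n] only, and [q b]
   extends greedily: send it to a common neighbour of finitely many points. *)
Lemma rich_embedding (X : relStr) (B : Type) (q : B -> nat -> X) :
  rich X -> inhabited B ->
  exists i : nat -> X,
    (forall k n, (forall b, edge (q b k) (q b n)) -> edge (i k) (i n)) /\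
    forall b, exists r : endo X, forall n, r (i n) = q b n.
Proof.
move=> richX [b0]; pose E k n := forall b, edge (q b k) (q b n).
have [/countable_injP[e einj] loops ext] := richX.
have fin_e N : finite_set [set x : X | e x <= N].
  apply: (@finite_preimage _ _ [set n | n <= N]) (finite_set_leq N).
  by move=> x y _ _; apply: einj; rewrite inE.
have fin_im (f : nat -> X) n : finite_set [set x | exists2 k, k < n & f k = x].
  exact: finite_image (finite_II n).
have [x0 _] : exists x : X, True.
  by have [|//|x] := ext set0 set0 set0; [exact: finite_set0|exists x].
pose old (l : seq X) x := exists2 k, k < size l & nth x0 l k = x.
pose near l x := old l x \/ e x <= size l.
have fin_near l : finite_set [set x | near l x].
  by rewrite finite_setU; split; [exact: fin_im|exact: fin_e].
pose R l v := ~ near l v /\ forall x, near l x ->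
  (edge x v <-> exists2 k, k < size l & nth x0 l k = x /\ E k (size l)) /\
  (edge v x <-> exists2 k, k < size l & nth x0 l k = x /\ E (size l) k).
have [l|i iP] := @history_choice X R.
  have [symX|v vF vP] := ext _
    [set x | exists2 k, k < size l & nth x0 l k = x /\ E k (size l)]
    [set x | exists2 k, k < size l & nth x0 l k = x /\ E (size l) k] (fin_near l).
    by apply/seteqP; split=> x [k kl [kx Ek]]; exists k => //; split=> // b; exact: symX.
  by exists v.
pose im n x := exists2 k, k < n & i k = x.
have oldE n x : old (mkseq i n) x <-> im n x.
  rewrite /old size_mkseq.
  by split=> -[k kn]; [rewrite nth_mkseq// => <-|move=> <-]; exists k; rewrite ?nth_mkseq.
have iinj_lt k n : k < n -> i k <> i n.
  by move=> kn ikn; apply: (iP n).1; left; apply/oldE; exists k.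
have iinj k n : i k = i n -> k = n.
  by move=> ikn; case: (ltngtP k n) => // /iinj_lt; rewrite ikn.
have edge_near n x : near (mkseq i n) x ->
    (edge x (i n) <-> exists2 k, k < n & i k = x /\ E k n) /\
    (edge (i n) x <-> exists2 k, k < n & i k = x /\ E n k).
  move=> /(iP n).2 []; rewrite size_mkseq => h1 h2; split.
    by split=> [/h1|[k kn [kx Ek]]]; [|apply/h1];
      [case=> k kn; rewrite nth_mkseq// => ?|]; exists k; rewrite ?nth_mkseq.
  by split=> [/h2|[k kn [kx Ek]]]; [|apply/h2];
    [case=> k kn; rewrite nth_mkseq// => ?|]; exists k; rewrite ?nth_mkseq.
have edge_lt k n : k < n ->
    (edge (i k) (i n) <-> E k n) /\ (edge (i n) (i k) <-> E n k).
  move=> kn; have [|h1 h2] := @edge_near n (i k).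
    by left; apply/oldE; exists k.
  split.
    by split=> [/h1[k' _ [/iinj<-]]//|Ekn]; apply/h1; exists k.
  by split=> [/h2[k' _ [/iinj<-]]//|Ekn]; apply/h2; exists k.
have reflE (x y : X) : edge x x -> edge y y by case: loops => h xx; [exact: h|case: (h x)].
have edge_i k n : edge (i k) (i n) <-> E k n.
  case: (ltngtP k n) => [/edge_lt[]|/edge_lt[]|<-]//.
  (* Loops are everywhere or nowhere, and [b0] extracts one from [E k k]. *)
  by split=> [ikk b|/(_ b0)]; [exact: reflE ikk|exact: reflE].
have edge_out n x : ~ (exists k, i k = x) -> e x <= n ->
    ~ edge x (i n) /\ ~ edge (i n) x.
  move=> xi xn; have [|h1 h2] := @edge_near n x; first by right; rewrite size_mkseq.
  by split=> [/h1|/h2] [k _ [kx _]]; apply: xi; exists k.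
exists i; split=> [k n /edge_i //|b].
(* A point [x] outside the image will go to [w (e x)]: its neighbours [i k] all have [k < e x], and
   [w (e x)] is adjacent to their images [q b k]. *)
have [l|w wP] := @history_choice X
    (fun l w => forall k, (k < size l -> edge (nth x0 l k) w /\ edge w (nth x0 l k)) /\
                          (k <= size l -> edge (q b k) w /\ edge w (q b k))).
  have [|//|w _ wP] := ext (old l `|` [set x | exists2 k, k < (size l).+1 & q b k = x])
    setT setT.
    by rewrite finite_setU; split; exact: fin_im.
  exists w => k; split=> kl.
    by have [|h1 h2] := wP (nth x0 l k); [left; exists k|split; [exact/h1|exact/h2]].
  by have [|h1 h2] := wP (q b k); [right; exists k|split; [exact/h1|exact/h2]].
have wq k n : k <= n -> edge (q b k) (w n) /\ edge (w n) (q b k).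
  by move=> kn; apply: (wP n k).2; rewrite size_mkseq.
have ww k n : k < n -> edge (w k) (w n) /\ edge (w n) (w k).
  by move=> kn; have [+ _] := wP n k; rewrite size_mkseq nth_mkseq//; apply.
have /choice[r rP] x : exists y, (forall n, x = i n -> y = q b n) /\
    (~ (exists n, i n = x) -> y = w (e x)).
  have [[n <-]|xi] := pselect (exists n, i n = x).
    by exists (q b n); split=> [k /iinj->//|]; case; exists n.
  by exists (w (e x)); split=> // n xn; case: xi; exists n.
have r_edge x y : edge x y -> edge (r x) (r y).
  have [[k <-]|xi] := pselect (exists k, i k = x);
    have [[n <-]|yi] := pselect (exists n, i n = y).
  - by rewrite !((rP _).1 _ erefl) => /edge_i.
  - rewrite ((rP _).1 _ erefl) ((rP _).2 yi) => xy.
    by apply: (wq _ _ _).1; rewrite leqNgt; apply/negP => /ltnW/(edge_out _ _ yi)[].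
  - rewrite ((rP _).1 _ erefl) ((rP _).2 xi) => xy.
    by apply: (wq _ _ _).2; rewrite leqNgt; apply/negP => /ltnW/(edge_out _ _ xi)[].
  - rewrite ((rP _).2 xi) ((rP _).2 yi) => xy.
    case: (ltngtP (e x) (e y)) => [/ww[]//|/ww[]//|exy].
    by move: xy; rewrite (einj _ _ _ _ exy) ?inE//; exact: reflE.
by exists (Endo r_edge) => n /=; exact: (rP _).1.
Qed.

Lemma rich_diagonalizable (X : relStr) : rich X -> diagonalizable X.
Proof.
move=> richX; have [/countable_injP[e einj] loops ext] := richX.
have [x0 _] : exists x : X, True.
  by have [|//|x] := ext set0 set0 set0; [exact: finite_set0|exists x].
exists e => [N|s u us].
  apply: (@finite_preimage _ _ [set n | n <= N]) (finite_set_leq N).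
  by move=> x y _ _; apply: einj; rewrite inE.
have /choice[dec decP] n : exists z : X * seq bool,
    forall x w, n = pickle (e x, w) -> z = (x, w).
  have [[[x w] ->]|nxw] := pselect (exists z : X * seq bool, n = pickle (e z.1, z.2)).
    exists (x, w) => x' w' /(pcan_inj pickleK)[exx' ->].
    by rewrite (einj _ _ _ _ exx') ?inE.
  by exists (x0, [::]) => x w nE; case: nxw; exists (x, w).
pose q b n := u (lcp (dec n).2 b) (dec n).1.
have [i [iE /choice[Q QP]]] := rich_embedding q richX (inhabits (fun=> false)).
pose P (a : nat -> bool) x := i (pickle (e x, mkseq a (e x))).
have qP (a : nat -> bool) b x : q b (pickle (e x, mkseq a (e x))) = u (lcp (mkseq a (e x)) b) x.
  by rewrite /q (decP _ _ _ erefl).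
have P_edge a x y : edge x y -> edge (P a x) (P a y).
  (* For fixed [b], the value prescribed at [P a x] is [s x] if [a = b], and otherwise [u N x] with
     [N] independent of [x]; both preserve edges. *)
  move=> xy; apply: iE => b; rewrite !qP.
  have [<-|ab] := pselect (a = b).
    by rewrite !lcp_mkseq !us //; exact: endo_edge.
  have [N abN] := lcp_mkseq_neq ab; rewrite !abN.
  have uN z : u (minn (e z) N) z = u N z.
    by case: (leqP (e z) N) => // zN; rewrite !us.
  by rewrite !uN; exact: endo_edge.
exists (fun a => Endo (P_edge a)), Q => a b x.
by rewrite /= QP qP.
Qed.

(** The new point lies outside [F], so loops do not affect its adjacency to [F]. *)
Lemma rich_add_loops (X : relStr) : rich X -> rich (add_loops X).
Proof.
move=> [cX loops ext]; split=> //=; first by left=> x; right.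
move=> F I O finF IO; have [|v vF vP] := ext F I O finF.
  by move=> symX; apply: IO => x y [/symX|->]; [left|right].
exists v => // x Fx; have [h1 h2] := vP x Fx.
have xv : x <> v by move=> xv; apply: vF; rewrite -xv.
by split; [rewrite -h1|rewrite -h2]; split=> [[//|xv']|]; [case: xv|left|case: xv|left].
Qed.

(** * Richness of the random graph and digraph *)

Definition substructure (X : relStr) (F : set X) : relStr :=
  @RelStr {x : X | F x} (fun x y => edge (sval x) (sval y)).

Lemma sval_inj (T : Type) (P : T -> Prop) : injective (@sval T P).
Proof. by move=> [x Px] [y Py] /= xy; exact: eq_exist. Qed.

Lemma finite_substructure (X : relStr) (F : set X) :
  finite_set F -> finite_set [set: substructure F].
Proof.
move=> finF; have -> : [set: substructure F] = (@sval X F) @^-1` F.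
  by apply/seteqP; split=> // -[x Fx].
by apply: finite_preimage finF => x y _ _; exact: sval_inj.
Qed.

Lemma fraisse_substructure (K : relStr -> Prop) (X : relStr) (F : set X) :
  fraisse_limit K X -> finite_set F -> K (substructure F).
Proof.
move=> [_ _ ageX] finF; apply/ageX; split; first exact: finite_substructure.
by exists sval; split=> //; exact: sval_inj.
Qed.

Definition one_point_extension (X : relStr) (F I O : set X) : relStr :=
  @RelStr (option {x : X | F x}) (fun a b =>
    match a, b with
    | Some x, Some y => edge (sval x) (sval y)
    | Some x, None => I (sval x)
    | None, Some y => O (sval y)
    | None, None => False
    end).

Lemma fraisse_rich (K : relStr -> Prop) (X : relStr) :
  fraisse_limit K X ->
  (forall A, K A -> finite_digraph A) ->
  (forall A, finite_digraph A ->
     ((forall x y : X, edge x y -> edge y x) ->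
        forall x y : A, edge x y -> edge y x) -> K A) ->
  rich X.
Proof.
move=> limX Kirr Kall; have [cX homX ageX] := limX.
have irrX (x : X) : ~ edge x x.
  have [_ irr] := Kirr _ (fraisse_substructure limX (finite_set1 x)).
  exact: (irr (exist _ x erefl)).
split=> //; first by right.
move=> F I O finF IO; set A := one_point_extension F I O.
have KA : K A.
  apply: Kall => [|symX]; last first.
    by rewrite -(IO symX) in A *; move=> [x|] [y|] //=; exact: symX.
  split=> [|[x|]]; [|exact: irrX|by []].
  have -> : [set: A] = Some @` [set: substructure F] `|` [set None].
    by apply/seteqP; split=> // -[x|] _; [left; exists x|right].
  rewrite finite_setU; split=> //.
  exact/finite_image/finite_substructure.
have [_ [f [finj fE]]] := (ageX A).2 KA.
(* [h] sends [F] to its copy inside the embedded extension. Homogeneity extends it to an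
   automorphism, whose inverse brings the new vertex back over [F]. *)
have /choice[h hP] x : exists y, forall Fx : F x, y = f (Some (exist _ x Fx)).
  have [Fx|nFx] := pselect (F x); last by exists x => Fx; case: (nFx Fx).
  by exists (f (Some (exist _ x Fx))) => Fx'; rewrite (Prop_irrelevance Fx Fx').
have [|x y Fx Fy|g [[g' gK g'K] gE] hg] := homX F h finF.
- move=> x y; rewrite !inE => Fx Fy.
  by rewrite (hP _ Fx) (hP _ Fy) => fxy; have [] := finj _ _ fxy.
- by rewrite (hP _ Fx) (hP _ Fy) -fE.
exists (g' (f None)) => [Fv|x Fx].
  by have := hg _ Fv; rewrite (hP _ Fv) g'K => /finj.
by split; rewrite gE g'K -(hg _ Fx) (hP _ Fx) -fE.
Qed.

Lemma random_digraph_rich (X : relStr) : random_digraph X -> rich X.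
Proof. by move=> limX; apply: (fraisse_rich limX). Qed.

Lemma random_graph_rich (X : relStr) : random_graph X -> rich X.
Proof.
move=> limX; apply: (fraisse_rich limX) => [A []//|A dA symA]; split=> //.
(* Symmetry of [X] is read off its substructures on at most two points. *)
apply: symA => x y.
have [_ sym] := fraisse_substructure limX (finite_set2 x y).
exact: (sym (exist _ x (or_introl erefl)) (exist _ y (or_intror erefl))).
Qed.

Theorem theorem5p3 (X : relStr) :
  (exists Y : relStr,
     [\/ random_graph Y,
         random_digraph Y |
         exists n : nat, isomorphic Y (copies nat (complete 'I_n))] /\
     (isomorphic X Y \/ isomorphic X (add_loops Y))) \/
  ((exists n : nat, isomorphic X (add_loops (copies 'I_n (complete nat)))) \/
   isomorphic X (add_loops (copies nat (complete nat)))) ->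
  automatic_continuity (endo X) second_countable_semigroup.
Proof.
move=> hX; apply: diagonalizable_automatic_continuity.
case: hX => [[Y [YP XY]]|[[n XY]|XY]]; first last.
- exact: isomorphic_diagonalizable XY diagonalizable_countable_equivalence.
- exact: isomorphic_diagonalizable XY (diagonalizable_finite_equivalence n).
have [richY|[n Yn]] : rich Y \/ exists n, isomorphic Y (copies nat (complete 'I_n)).
  by case: YP => [/random_graph_rich ?|/random_digraph_rich ?|?]; [left|left|right].
  case: XY => XY; apply: (isomorphic_diagonalizable XY); apply: rich_diagonalizable => //.
  exact: rich_add_loops.
case: XY => XY; apply: (isomorphic_diagonalizable XY).
  apply: (isomorphic_diagonalizable Yn).
  apply: diagonalizable_copies; exact: finite_finset.
apply: (isomorphic_diagonalizable (isomorphic_add_loops Yn)).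
apply: (isomorphic_diagonalizable (isomorphic_add_loops_copies _ _)).
apply: diagonalizable_copies; exact: finite_finset.
Qed.
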